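(* Let $P_k$ be the path graph on $k$ vertices, with $k\geq 3$, and let $\Gamma_n^{P_k}$ be the $n$-th Schreier graph of the graph automaton group $\mathcal{G}_{P_k}$. Then, for every $n\geq 1$, $$diam(\Gamma_{n}^{P_k})=2^{n+1}+(k-1)(2n-1)-4n.$$
   Context: Graph automaton group: given a finite simple graph $G=(V,E)$, choose an orientation of every edge and let $E'$ be the resulting set of ordered pairs. Let $V^n$ be the set of words of length $n$ over the alphabet $V$ and $V^*=\bigcup_{n\ge0}V^n$. Each oriented edge $e=(x,y)\in E'$ acts as a length-preserving bijection of $V^*$ defined recursively by $e(\emptyset)=\emptyset$, $e(xw)=y\,e(w)$, $e(yw)=xw$, and $e(zw)=zw$ for $z\in V\setminus\{x,y\}$, $w\in V^*$. The group $\mathcal{G}_G$ is the group of bijections of $V^*$ generated by the elements of $E'$ (it does not depend on the orientation). The $n$-th Schreier graph $\Gamma_n^G$ is the undirected graph with vertex set $V^n$ in which $u$ and $v$ are joined by an edge if $v=e(u)$ or $v=e^{-1}(u)$ for some $e\in E'$ (it does not depend on the orientation). The diameter $diam$ of a connected graph is the maximum of the geodesic distances between pairs of its vertices. The path graph $P_k$ has vertices $1,\ldots,k$ and edges $\{i,i+1\}$, $1\le i\le k-1$. *)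

(* Defs.v *)
From HB Require Import structures.
From mathcomp Require Import all_boot all_fingroup.

Set Implicit Arguments.
Unset Strict Implicit.
Unset Printing Implicit Defensive.

Record sgraph := SGraph {
  vertex :> finType;
  adj : rel vertex;
  adj_sym : symmetric adj;
  adj_irr : irreflexive adj }.

(* [o x y] means that the edge {x, y} is oriented as (x, y). *)
Definition orientation (G : sgraph) (o : rel G) : Prop :=
  (forall x y, o x y -> adj x y) /\
  (forall x y, adj x y -> o x y (+) o y x).

Fixpoint edge_act (V : eqType) (x y : V) (w : seq V) : seq V :=
  if w is z :: w' then
    if z == x then y :: edge_act x y w'
    else if z == y then x :: w'
    else z :: w'
  else [::].

Lemma size_edge_act (V : eqType) (x y : V) (w : seq V) :
  size (edge_act x y w) = size w.
Proof.
by elim: w => //= z w IHw; case: ifP => _ /=; [rewrite IHw | case: ifP].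
Qed.

Lemma edge_act_inj (V : eqType) (x y : V) : injective (edge_act x y).
Proof.
elim=> [|a u IHu] [|b v] //=; try by do 2?case: ifP => // _.
have [-> | nax] := eqVneq a x; have [-> | nbx] := eqVneq b x.
- by case=> /IHu ->.
- have [eby | nby] := eqVneq b y; case=> e _.
    by rewrite eby e eqxx in nbx.
  by rewrite -e eqxx in nby.
- have [eay | nay] := eqVneq a y; case=> e _.
    by rewrite eay e eqxx in nax.
  by rewrite e eqxx in nay.
have [-> | nay] := eqVneq a y; have [-> | nby] := eqVneq b y.
- by case=> ->.
- by case=> e; rewrite -e eqxx in nbx.
- by case=> e; rewrite e eqxx in nax.
by case=> -> ->.
Qed.

Lemma edge_act_tupleP (V : eqType) (n : nat) (x y : V) (w : n.-tuple V) :
  size (edge_act x y w) == n.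
Proof. by rewrite size_edge_act size_tuple. Qed.

Definition edge_tuple (V : eqType) (n : nat) (x y : V) (w : n.-tuple V) :
  n.-tuple V := Tuple (edge_act_tupleP x y w).

Lemma edge_tuple_inj (V : eqType) (n : nat) (x y : V) :
  injective (@edge_tuple V n x y).
Proof. by move=> u v /(congr1 val) /edge_act_inj /val_inj. Qed.

Definition edge_perm (V : finType) (n : nat) (x y : V) : {perm n.-tuple V} :=
  perm (@edge_tuple_inj V n x y).

(* Loops, at the words fixed by some oriented edge, are kept; they do not
   affect distances. *)
Definition schreier (G : sgraph) (o : rel G) (n : nat) : rel (n.-tuple G) :=
  fun u v => [exists x : G, exists y : G,
    o x y && ((v == edge_perm n x y u) || (v == (edge_perm n x y)^-1%g u))].

Definition connected_graph (T : finType) (e : rel T) : Prop :=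
  forall u v, exists m, [exists p : m.-tuple T, path e u p && (last u p == v)].

Definition gdist (T : finType) (e : rel T) (He : connected_graph e)
  (u v : T) : nat := ex_minn (He u v).

Definition diam (T : finType) (e : rel T) (He : connected_graph e) : nat :=
  \max_(u : T) \max_(v : T) gdist He u v.

Definition path_adj (k : nat) : rel 'I_k :=
  fun i j => (i.+1 == j :> nat) || (j.+1 == i :> nat).

Lemma path_adj_sym (k : nat) : symmetric (@path_adj k).
Proof. by move=> i j; rewrite /path_adj orbC. Qed.

Lemma path_adj_irr (k : nat) : irreflexive (@path_adj k).
Proof. by move=> i; rewrite /path_adj orbb gtn_eqF. Qed.

(* The vertices are numbered from 0 to k - 1. *)
Definition path_graph (k : nat) : sgraph :=
  SGraph (@path_adj_sym k) (@path_adj_irr k).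

(* Main.v *)
Require Import Defs.
From mathcomp Require Import all_boot all_fingroup.
From mathcomp Require Import zify.

(* Write K = k - 1. The edge (x, x + 1) acts on the words over {x, x + 1} of
   length n as a binary odometer, so these words form a cycle of length 2^n; it
   meets the cycle of {x + 1, x + 2} in the constant word (x + 1)^n, which is
   adjacent to x^n and to (x + 2)^n. The Schreier graph is a tree of cycles,
   and by induction on n every word is at distance at most
   M = 2^(n-1) - 1 + (n-1)(K-2) from one of these largest cycles. Any two words
   are then joined by a path of length at most
   M + 2^(n-1) + (K-2) + 2^(n-1) + M, which is the announced diameter.
   Conversely, the words alternating the letters 0 and K attain this bound: a
   1-Lipschitz function separates them, obtained by unrolling the tree of cycles
   along the geodesic that joins them through the cut vertices 1^n, ...,
   (K-1)^n. *)

(** * Edge actions and paths on words of natural numbers *)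

Lemma edge_actK (V : eqType) (x y : V) :
  x != y -> cancel (edge_act x y) (edge_act y x).
Proof.
move=> nxy; elim=> //= z w IHw.
have [->|nzx] := eqVneq z x; first by rewrite /= eqxx IHw.
have [->|nzy] := eqVneq z y; first by rewrite /= (negbTE nxy) eqxx.
by rewrite /= (negbTE nzx) (negbTE nzy).
Qed.

Lemma edge_act_nseq_cat (V : eqType) (x y : V) n s :
  edge_act x y (nseq n x ++ s) = nseq n y ++ edge_act x y s.
Proof. by elim: n => //= n ->; rewrite eqxx. Qed.

Lemma edge_act_fix (V : eqType) (x y z : V) s :
  z != x -> z != y -> edge_act x y (z :: s) = z :: s.
Proof. by move=> /= /negbTE -> /negbTE ->. Qed.

Lemma map_edge_act (V W : eqType) (f : V -> W) x y w :
  injective f -> map f (edge_act x y w) = edge_act (f x) (f y) (map f w).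
Proof.
move=> f_inj; elim: w => //= z w IHw.
by rewrite !(inj_eq f_inj); case: ifP => _ /=; [rewrite IHw | case: ifP].
Qed.

Definition step K (u v : seq nat) : Prop :=
  exists x y, [/\ x <= K, y <= K, (x.+1 == y) || (y.+1 == x)
                & v = edge_act x y u].

(** The base case holds for every [m], so [m] only bounds the length of a path. *)
Inductive within K : nat -> seq nat -> seq nat -> Prop :=
| within_refl m u : within K m u u
| within_step m u v w : step K u v -> within K m v w -> within K m.+1 u w.

Lemma step_sym K u v : step K u v -> step K v u.
Proof.
move=> [x [y [hx hy hxy ->]]]; exists y, x; split=> //; first by rewrite orbC.
by rewrite edge_actK //; lia.
Qed.

Lemma step_edge K x u : x < K -> step K u (edge_act x x.+1 u).
Proof. by move=> hx; exists x, x.+1; rewrite eqxx; split=> //; lia. Qed.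

Lemma within_weaken {K m} m' {u v} :
  m <= m' -> within K m u v -> within K m' u v.
Proof.
move=> le_m hw; elim: hw m' le_m => [*|{}m {}u w {}v hs _ IHw [|m'] //].
  by left.
by rewrite ltnS => /IHw; apply: within_step.
Qed.

Lemma within_trans {K m m' u v w} :
  within K m u v -> within K m' v w -> within K (m + m') u w.
Proof.
elim=> [{}m {}u|{}m {}u {}v w' hs _ IHw /IHw]; last exact: within_step.
by apply: within_weaken; rewrite leq_addl.
Qed.

Lemma within_sym {K m u v} : within K m u v -> within K m v u.
Proof.
elim=> [*|{}m {}u {}v w /step_sym hs _ hw]; first by left.
rewrite -addn1; apply: within_trans hw _; apply: within_step hs _; left.
Qed.

(** * Upper bound: odometer cycles and the chain of cut vertices *)

Lemma within_iter K x t u :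
  x < K -> within K t u (iter t (edge_act x x.+1) u).
Proof.
move=> hx; elim: t u => [|t IHt] u; first by left.
by rewrite iterSr; apply: within_step (IHt _); apply: step_edge.
Qed.

(* On words over {x, y}, the edge (x, y) is a binary odometer, least
   significant letter first, with y as the digit 0 and x as the digit 1. *)
Fixpoint value (x : nat) (p : seq nat) : nat :=
  if p is z :: p' then (z == x) + (value x p').*2 else 0.

(** Two ticks restore the lowest digit and carry one tick to the rest. *)
Lemma iter_edge_act_double (V : eqType) (x y : V) t w : x != y ->
  iter t.*2 (edge_act x y) (y :: w) = y :: iter t (edge_act x y) w.
Proof.
move=> nxy; elim: t => //= t ->; rewrite /= eq_sym (negbTE nxy) eqxx /=.
by rewrite eqxx.
Qed.

Lemma iter_value x p s : all (fun z => (z == x) || (z == x.+1)) p ->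
  iter (value x p) (edge_act x x.+1) (nseq (size p) x.+1 ++ s) = p ++ s.
Proof.
elim: p => //= z p IHp /andP[/orP hz /IHp{}IHp].
have nx : x != x.+1 by lia.
rewrite iterD iter_edge_act_double // IHp.
case: hz => /eqP ->; rewrite ?eqxx /=; last by rewrite eq_sym (negbTE nx).
by rewrite [_.+1 == _]eq_sym (negbTE nx) eqxx.
Qed.

Lemma iter_edge_act_full (V : eqType) (x y : V) n s : x != y ->
  iter (2 ^ n) (edge_act x y) (nseq n y ++ s) = nseq n y ++ edge_act x y s.
Proof.
by move=> nxy; elim: n => //= n IHn; rewrite expnS mul2n
  iter_edge_act_double // IHn.
Qed.

Lemma value_lt x p : value x p < 2 ^ size p.
Proof. by elim: p => //= z p IHp; rewrite expnS; lia. Qed.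

(** The cycle has length 2^(n+1), so one of its two arcs has length at most 2^n; a suffix fixed by
    the edge survives the carry of a full turn. *)
Lemma within_cycle K x n p q s : x < K -> edge_act x x.+1 s = s ->
  all (fun z => (z == x) || (z == x.+1)) p ->
  all (fun z => (z == x) || (z == x.+1)) q ->
  size p = n.+1 -> size q = n.+1 -> within K (2 ^ n) (p ++ s) (q ++ s).
Proof.
move=> hx fix_s; wlog le_pq : p q / value x p <= value x q.
  move=> IH hp hq sp sq.
  have [le_pq|/ltnW le_qp] := leqP (value x p) (value x q); first exact: IH.
  by apply: within_sym; apply: IH.
move=> hp hq sp sq.
set e := edge_act x x.+1; set o := nseq n.+1 x.+1 ++ s.
have ep : iter (value x p) e o = p ++ s by rewrite /o -sp iter_value.
have eq : iter (value x q) e o = q ++ s by rewrite /o -sq iter_value.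
have hvq := value_lt x q; rewrite sq expnS in hvq.
have [le_d|lt_d] := leqP (value x q - value x p) (2 ^ n).
  apply: within_weaken le_d _.
  rewrite -eq -(subnK le_pq) iterD ep addnK; exact: within_iter.
(* Otherwise the other arc, from [q] to [p], passes through the zero word [o]. *)
apply: within_sym.
have -> : p ++ s = iter (2 * 2 ^ n + value x p - value x q) e (q ++ s).
  rewrite -eq -iterD subnK; last by lia.
  by rewrite addnC iterD -expnS iter_edge_act_full ?fix_s // neq_ltn ltnSn.
by apply: (@within_weaken _ _ _ _ _ _ (within_iter _ _ _ _ hx)); lia.
Qed.

Lemma within_chain K n i j s : i <= j <= K ->
  (forall x, i <= x < j -> edge_act x x.+1 s = s) ->
  within K (j - i) (nseq n i ++ s) (nseq n j ++ s).
Proof.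
elim: j => [|j IHj] hij fix_s; first by (have -> : i = 0 by lia); left.
have [->|ne_ij] := eqVneq i j.+1; first by left.
rewrite subSn; last by lia.
rewrite -addn1; apply: (@within_trans _ _ _ _ (nseq n j ++ s)).
  by apply: IHj; [lia|move=> x hx; apply: fix_s; lia].
rewrite -[in nseq n j.+1 ++ s](fix_s j); last by lia.
rewrite -edge_act_nseq_cat; apply: (within_iter _ _ 1); lia.
Qed.

(* Quantifying over the suffix [s] expresses that the path does not use the
   edges joining two constant words, the only ones that act on a suffix. *)
Lemma within_big_cycle K n w : 2 <= K -> size w = n.+1 -> all (leq^~ K) w ->
  exists x p, [/\ x < K, all (fun z => (z == x) || (z == x.+1)) p, size p = n.+1
    & forall s, within K (2 ^ n - 1 + n * (K - 2)) (w ++ s) (p ++ s)].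
Proof.
move=> hK; elim: n w => [|n IHn] w.
  case: w => [|z [|]] // _ /andP[hz _].
  (* The edge {z, z + 1} contains [z]; only [z = K] needs {K - 1, K} instead. *)
  exists (minn z K.-1), [:: z]; split=> //; first by lia.
    by rewrite /= in hz *; rewrite andbT; lia.
  by move=> s; left.
case/lastP: w => [//|w z]; rewrite size_rcons all_rcons => -[sw] /andP[hz hw].
have [x [p [hx hp sp hwp]]] := IHn _ sw hw.
have h2 : 0 < 2 ^ n by rewrite expn_gt0.
(* If [z] lies outside {x, x + 1}, at most half a cycle leads to the cut vertex on the side of [z],
   then at most [K - 2] chain steps lead to the constant prefix of the letter next to [z]; all these
   edges fix [z]. *)
have [lt_zx|le_xz] := ltnP z x.
  exists z, (rcons (nseq n.+1 z.+1) z); split; first by lia.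
  - by rewrite all_rcons eqxx all_nseq eqxx orbT.
  - by rewrite size_rcons size_nseq.
  move=> s; rewrite !cat_rcons.
  apply: (@within_weaken _ ((2 ^ n - 1 + n * (K - 2)) + (2 ^ n + (x - z.+1)))).
    by rewrite expnS ?mulSn; lia.
  apply: within_trans (hwp _) _.
  apply: (@within_trans _ _ _ _ (nseq n.+1 x ++ z :: s)).
    apply: (@within_cycle _ x) => //; first by rewrite edge_act_fix //; lia.
    - by rewrite all_nseq eqxx orbT.
    - by rewrite size_nseq.
  apply: within_sym; apply: within_chain; first by lia.
  by move=> i hi; rewrite edge_act_fix //; lia.
have [le_zx|lt_xz] := leqP z x.+1.
  exists x, (rcons p z); split=> //; first by rewrite all_rcons hp andbT; lia.
    by rewrite size_rcons sp.
  move=> s; rewrite !cat_rcons; apply: within_weaken (hwp _).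
  by rewrite expnS ?mulSn; lia.
exists z.-1, (rcons (nseq n.+1 z.-1) z); split; first by lia.
- by rewrite all_rcons all_nseq eqxx; lia.
- by rewrite size_rcons size_nseq.
move=> s; rewrite !cat_rcons.
apply: (@within_weaken _ ((2 ^ n - 1 + n * (K - 2)) + (2 ^ n + (z.-1 - x.+1)))).
  by rewrite expnS ?mulSn; lia.
apply: within_trans (hwp _) _.
apply: (@within_trans _ _ _ _ (nseq n.+1 x.+1 ++ z :: s)).
  apply: (@within_cycle _ x) => //; first by rewrite edge_act_fix //; lia.
  - by rewrite all_nseq eqxx !orbT.
  - by rewrite size_nseq.
apply: within_chain; first by lia.
by move=> i hi; rewrite edge_act_fix //; lia.
Qed.

Lemma within_words K n u v : 2 <= K -> size u = n.+1 -> size v = n.+1 ->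
  all (leq^~ K) u -> all (leq^~ K) v ->
  within K (2 ^ n.+2 - 2 + n.*2.+1 * (K - 2)) u v.
Proof.
move=> hK su sv hu hv.
have [x [p [hx hp sp /(_ [::]) hup]]] := within_big_cycle _ _ _ hK su hu.
have [y [q [hy hq sq /(_ [::]) hvq]]] := within_big_cycle _ _ _ hK sv hv.
rewrite !cats0 in hup hvq.
have h2 : 0 < 2 ^ n by rewrite expn_gt0.
suff hpq : within K (2 ^ n.+1 + (K - 2)) p q.
  have := within_trans hup (within_trans hpq (within_sym hvq)).
  by apply: within_weaken; rewrite !expnS; lia.
clear u v su sv hu hv hup hvq.
wlog le_xy : x y p q hx hy hp hq sp sq / x <= y.
  move=> IH; have [|/ltnW] := leqP x y; first exact: IH.
  by move=> le_yx; apply: within_sym; apply: IH le_yx.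
have [eq_xy|ne_xy] := eqVneq x y.
  apply: (@within_weaken _ (2 ^ n)); first by rewrite expnS ?mulSn; lia.
  rewrite -[p]cats0 -[q]cats0; apply: (@within_cycle _ x) => //.
  by rewrite eq_xy.
apply: (@within_weaken _ (2 ^ n + ((y - x.+1) + 2 ^ n))).
  by rewrite expnS; lia.
rewrite -[p]cats0 -[q]cats0.
apply: (@within_trans _ _ _ _ (nseq n.+1 x.+1 ++ [::])).
  apply: (@within_cycle _ x) => //; last by rewrite size_nseq.
  by rewrite all_nseq eqxx !orbT.
apply: (@within_trans _ _ _ _ (nseq n.+1 y ++ [::])).
  by apply: within_chain; first by lia.
apply: (@within_cycle _ y) => //; last by rewrite size_nseq.
by rewrite all_nseq eqxx orbT.
Qed.

(** * Lower bound: coordinates on the tree of cycles *)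

(* [edge_act] on words listed from the last letter. *)
Fixpoint edge_act_rev (x y : nat) (r : seq nat) : seq nat :=
  if r is z :: r' then
    (if all (pred1 x) r' then (if z == x then y else if z == y then x else z)
     else z) :: edge_act_rev x y r'
  else [::].

Lemma size_edge_act_rev x y r : size (edge_act_rev x y r) = size r.
Proof. by elim: r => //= z r ->. Qed.

(** The carry reaches the last letter exactly when all letters before it are [x]. *)
Lemma edge_act_rcons (x y : nat) w z : edge_act x y (rcons w z) =
  rcons (edge_act x y w)
    (if all (pred1 x) w then (if z == x then y else if z == y then x else z)
     else z).
Proof.
elim: w => [|a w IHw] /=; first by do 2?case: ifP.
by rewrite IHw; case: (a == x) => //; case: (a == y).
Qed.

Lemma rev_edge_act x y w : rev (edge_act x y w) = edge_act_rev x y (rev w).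
Proof.
elim/last_ind: w => // w z IHw.
by rewrite edge_act_rcons !rev_rcons /= IHw all_rev.
Qed.

(* The flag [m] selects the end 0 or the end K of the alphabet, so that each
   definition below serves for both ends. *)
Definition mir K (m : bool) z := if m then K - z else z.

(* The position, on the largest cycle over the letters {0, 1}, of the vertex of
   that cycle closest to the word; it is 0 at the cut vertex 1^n and at all the
   words behind it. *)
Fixpoint odometer K m (r : seq nat) : nat :=
  if r is z :: r' then
    if mir K m z == 0 then 2 ^ size r' + odometer K m r'
    else if mir K m z == 1 then odometer K m r' else 0
  else 0.

(* The position of the word along the cut vertices 1^n, ..., (K-1)^n, counted
   from 1^n; it is read off the last letter alone. *)
Definition chain K m (r : seq nat) : nat :=
  minn (mir K m (head (mir K m 0) r) - 1) (K - 2).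

(* The depth of the word behind 1^n, on the side of 0^n. It follows the largest
   cycle up to the antipode 1^(n-1) 0 of 1^n and then enters the smaller copy
   hanging there, which is traversed towards the other end of the alphabet. *)
Fixpoint far K m (r : seq nat) : nat :=
  if r is z :: r' then
    if mir K m z == 0 then
      2 ^ size r' - odometer K m r' + (far K (~~ m) r' + chain K m r')
    else if mir K m z == 1 then odometer K m r' else 0
  else 0.

Lemma mirN K m z : z <= K -> mir K (~~ m) z = K - mir K m z.
Proof. by case: m => /= hz; rewrite /mir; lia. Qed.

Lemma odometer_lt K m r : odometer K m r < 2 ^ size r.
Proof. by elim: r => //= z r IHr; rewrite expnS; do 2?case: ifP => _; lia. Qed.

Lemma odometer_disj K m r : 2 <= K -> all (leq^~ K) r ->
  0 < odometer K m r -> odometer K (~~ m) r = 0.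
Proof.
move=> hK; elim: r => //= z r IHr /andP[hz hr]; rewrite !mirN //.
by repeat (case: ifP => ?); try lia; apply: IHr.
Qed.

Lemma chain_cons K m z r : chain K m (z :: r) = minn (mir K m z - 1) (K - 2).
Proof. by []. Qed.

(** The coordinates live on different parts of the tree; when [K = 2], both sides share the last
    letter 1 and [odometer_disj] separates them. *)
Lemma far_disj K m r : 2 <= K -> all (leq^~ K) r ->
  0 < far K m r -> far K (~~ m) r = 0 /\ chain K m r = 0.
Proof.
move=> hK; case: r => // z r; rewrite chain_cons /= => /andP[hz hr]; rewrite !mirN //.
by repeat (case: ifP => ?); try lia; move=> h; split; try lia; apply: odometer_disj.
Qed.

Definition binary K m := all (fun z => mir K m z < 2).

(** On such words the two inner terms of [far] vanish, so there only [odometer] can move it. *)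
Lemma binary_far K m r : 2 <= K -> all (leq^~ K) r -> binary K m r ->
  far K (~~ m) r = 0 /\ chain K m r = 0.
Proof.
move=> hK; have odo0 s : all (leq^~ K) s -> binary K m s -> odometer K (~~ m) s = 0.
  elim: s => //= z s IHs /andP[hz hs] /andP[bz bs]; rewrite mirN //.
  by repeat (case: ifP => ?); try lia; apply: IHs.
case: r => [|z r]; first by rewrite /chain /mir /=; case: m {odo0}; lia.
rewrite chain_cons /= => /andP[hz hr] /andP[bz br]; rewrite mirN //.
by repeat (case: ifP => ?); split; try lia; apply: odo0.
Qed.

Definition adjacent K x y := [&& x <= K, y <= K & (x.+1 == y) || (y.+1 == x)].

Definition first_edge K m x y := (mir K m x < 2) && (mir K m y < 2).

Lemma odometer_nseq K m n c : c <= K ->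
  odometer K m (nseq n c) = if mir K m c == 0 then 2 ^ n - 1 else 0.
Proof.
move=> hc; elim: n => [|n IHn] /=; first by case: ifP.
rewrite IHn size_nseq; have := expn_gt0 2 n; rewrite expnS.
by repeat (case: ifP => ?); lia.
Qed.

Lemma edge_act_rev_nseq x y n : edge_act_rev x y (nseq n x) = nseq n y.
Proof. by elim: n => //= n ->; rewrite all_nseq /= eqxx orbT. Qed.

(** The constant word of [x] is excluded because moving between 0^n and 1^n closes the cycle, where
    the position jumps by 2^n - 1. *)
Lemma odometer_step K m x y r : all (leq^~ K) r -> adjacent K x y ->
  ~~ all (pred1 x) r -> let r' := edge_act_rev x y r in
  odometer K m r' = odometer K m r \/
  [/\ first_edge K m x y, binary K m r, binary K m r' &
   (odometer K m r' == (odometer K m r).+1) ||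
   (odometer K m r == (odometer K m r').+1)].
Proof.
elim: r => // z r IHr /= /andP[hz hr] hxy.
have size_r2 := size_edge_act_rev x y r.
have [all_x|nall_x _] := boolP (all (pred1 x) r); last first.
  have := IHr hr hxy nall_x; rewrite size_r2.
  have [mz|nz0] := eqVneq (mir K m z) 0.
    by case=> [->|[-> -> -> h]]; [left|right; split=> //; lia].
  have [mz|nz1] := eqVneq (mir K m z) 1; last by left.
  by case=> [->|[-> -> -> h]]; [left|right; split=> //; lia].
rewrite andbT => nzx; move: size_r2; clear IHr.
have /and3P[hx hy hadj] := hxy.
rewrite (negbTE nzx) (all_pred1P _ _ all_x) !edge_act_rev_nseq => _.
rewrite !size_nseq !odometer_nseq // /binary /first_edge !all_nseq.
have h2 : 0 < 2 ^ size r by rewrite expn_gt0.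
case: (eqVneq z y) => [->|nzy] /=.
  by rewrite /mir; case: m; repeat (case: ifP => ?); (left; lia) || (right; split; lia).
by rewrite /mir; case: m; repeat (case: ifP => ?); (left; lia) || (right; split; lia).
Qed.

Lemma odometer_step_other K m x y r : all (leq^~ K) r -> adjacent K x y ->
  ~~ first_edge K m x y -> odometer K m (edge_act_rev x y r) = odometer K m r.
Proof.
move=> hr hxy nf; have [all_x|nall_x] := boolP (all (pred1 x) r); last first.
  by case: (odometer_step K m x y r hr hxy nall_x) => // -[f]; rewrite f in nf.
have /and3P[hx hy hadj] := hxy; move: nf.
rewrite (all_pred1P _ _ all_x) edge_act_rev_nseq !odometer_nseq //.
rewrite /first_edge /mir; case: m; repeat (case: ifP => ?); lia.
Qed.

Lemma all_edge_act_rev K x y r : adjacent K x y ->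
  all (leq^~ K) r -> all (leq^~ K) (edge_act_rev x y r).
Proof.
move=> /and3P[hx hy _]; elim: r => //= z r IHr /andP[hz /IHr ->].
by rewrite andbT; do 3?case: ifP.
Qed.

Lemma far_nseq K m n z c : 2 <= K -> z <= K -> c <= K ->
  (c == z) || adjacent K c z ->
  far K m (z :: nseq n c) =
    if mir K m z == 0 then (if mir K m c == 0 then 1 else 2 ^ n)
    else if (mir K m z == 1) && (mir K m c == 0) then 2 ^ n - 1 else 0.
Proof.
move=> hK hz hc hzc /=; have h2 : 0 < 2 ^ n by rewrite expn_gt0.
rewrite size_nseq odometer_nseq //.
case: ifP => hz0 /=; last by repeat (case: ifP => //= ?); lia.
have [||-> ->] := binary_far K m (nseq n c) hK; rewrite /binary ?all_nseq ?hc ?orbT //.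
  by move: hzc hz0; rewrite /adjacent /mir; case: m; lia.
by case: ifP => ?; lia.
Qed.

Lemma far_constant K m n c : 2 <= K -> c <= K ->
  far K m (c :: nseq n c) = (mir K m c == 0).
Proof.
by move=> hK hc; rewrite far_nseq ?eqxx //; case: eqP => // _; rewrite andbF.
Qed.

Lemma adjacent_mir K m x y : adjacent K x y -> adjacent K (mir K m x) (mir K m y).
Proof. by rewrite /adjacent /mir; case: m; lia. Qed.

Lemma adjacentC K x y : adjacent K x y = adjacent K y x.
Proof. by rewrite /adjacent; lia. Qed.

(** The two words are consecutive halfway along their cycle. In mirrored letters, their depths are
    2^n and 2^n - 1 for the edge {0, 1}, and 0 for all others. *)
Lemma far_cross K m n x y : 2 <= K -> adjacent K x y ->
  far K m (x :: nseq n y) = far K m (y :: nseq n x) \/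
  [/\ far K m (x :: nseq n y) <= (far K m (y :: nseq n x)).+1,
      far K m (y :: nseq n x) <= (far K m (x :: nseq n y)).+1 &
      first_edge K m x y].
Proof.
move=> hK hxy; have /and3P[hx hy _] := hxy.
rewrite !far_nseq ?hxy 1?adjacentC ?hxy ?orbT // /first_edge.
have h2 : 0 < 2 ^ n by rewrite expn_gt0.
have := adjacent_mir K m x y hxy; rewrite /adjacent.
case: (mir K m x) (mir K m y) => [|[|a]] [|[|b]] //= ?; rewrite ?andbF /=;
  by (left; lia) || (right; split; lia).
Qed.

(** * The Lipschitz property *)

(* The function [chain K m + far K (~~ m) - far K m] is 1-Lipschitz; it is
   compared at two words without truncated subtraction. *)
Definition height_step K m r r' :=
  chain K m r + far K (~~ m) r + far K m r' <=
    (chain K m r' + far K (~~ m) r' + far K m r).+1.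

Lemma chain_le K m r : chain K m r <= K - 2.
Proof. exact: geq_minr. Qed.

Lemma chainN K m r : 2 <= K -> all (leq^~ K) r -> r != [::] ->
  chain K (~~ m) r = K - 2 - chain K m r.
Proof.
by move=> hK; case: r => // z r /andP[hz _] _; rewrite !chain_cons mirN //; lia.
Qed.

(** On nonempty words, exchanging the two ends turns a height [h] into [K - 2 - h], so the bounds
    for both flags give both signs. *)
Lemma height_step_sym K r r' : 2 <= K ->
  all (leq^~ K) r -> all (leq^~ K) r' -> size r = size r' ->
  (forall m, height_step K m r r') -> forall m, height_step K m r' r.
Proof.
move=> hK hr hr' eq_size lip m; have := lip (~~ m); rewrite /height_step negbK.
case: r hr eq_size {lip} => [|z r] hr eq_size.
  by case: r' eq_size hr' => // *; exact: leqnSn.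
have nr' : r' != [::] by case: r' eq_size hr'.
have := chainN K m _ hK hr isT; have := chainN K m _ hK hr' nr'.
by have := chain_le K m (z :: r); have := chain_le K m r'; lia.
Qed.

(* [height_step] bounds the variation of a difference of two quantities that
   are never both nonzero, hence the variation of each of them. *)
Lemma depth_step K m r r' : 2 <= K ->
  all (leq^~ K) r -> all (leq^~ K) r' -> size r = size r' ->
  (forall m, height_step K m r r') ->
  chain K m r + far K (~~ m) r <= (chain K m r' + far K (~~ m) r').+1.
Proof.
move=> hK hr hr' eq_size lip.
have := lip m; have := height_step_sym K r r' hK hr hr' eq_size lip m.
rewrite /height_step; have := far_disj K m r hK hr; have := far_disj K m r' hK hr'.
have [->|f'] := posnP (far K m r'); last by move=> /(_ isT)[]; lia.
have [->|f] := posnP (far K m r); last by move=> _ /(_ isT)[]; lia.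
by lia.
Qed.

(** Here the last letter [z] stays. If it is the end letter, either [odometer] is constant and only
    the inner terms may move, or these vanish by [binary_far]. The last clause records at which end
    the change occurs. *)
Lemma far_step K m x y z r : 2 <= K -> all (leq^~ K) r -> z <= K ->
  adjacent K x y ->
  (forall m, height_step K m r (edge_act_rev x y r)) ->
  ~~ (all (pred1 x) r && ((z == x) || (z == y))) ->
  let r' := edge_act_rev x y r in
  far K m (z :: r') = far K m (z :: r) \/
  [/\ far K m (z :: r') <= (far K m (z :: r)).+1,
      far K m (z :: r) <= (far K m (z :: r')).+1 &
      (mir K m z == 0) || (mir K m z == 1) && first_edge K m x y].
Proof.
move=> hK hr hz hxy lip ncross /=.
have hr2 : all (leq^~ K) (edge_act_rev x y r) by apply: all_edge_act_rev.
have size_r2 := size_edge_act_rev x y r.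
(* The third alternative covers the jump of [odometer] at a constant word: [z] is then outside the
   mirrored {0, 1}, where [far] is 0. *)
have odo_step : odometer K m (edge_act_rev x y r) = odometer K m r \/
  [/\ first_edge K m x y, binary K m r, binary K m (edge_act_rev x y r) &
   (odometer K m (edge_act_rev x y r) == (odometer K m r).+1) ||
   (odometer K m r == (odometer K m (edge_act_rev x y r)).+1)] \/ 1 < mir K m z.
  have [all_x|nall_x] := boolP (all (pred1 x) r); last first.
    by have [] := odometer_step K m x y r hr hxy nall_x; [left|right; left].
  have [f|nf] := boolP (first_edge K m x y); last by left; apply: odometer_step_other.
  right; right; rewrite all_x /= in ncross.
  by move: f hxy ncross; rewrite /first_edge /adjacent /mir; case: (m); lia.
have := odometer_lt K m r; have := odometer_lt K m (edge_act_rev x y r).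
rewrite size_r2 => lt2 lt1.
have [mz|nz0] := eqVneq (mir K m z) 0.
  case: odo_step => [->|[[f b1 b2 h]|]]; last by lia.
    right; have := depth_step K m r _ hK hr hr2 (esym size_r2) lip.
    have := depth_step K m _ r hK hr2 hr size_r2
      (height_step_sym K r _ hK hr hr2 (esym size_r2) lip).
    by split=> //; lia.
  have [-> ->] := binary_far K m _ hK hr b1.
  by have [-> ->] := binary_far K m _ hK hr2 b2; right; split=> //; lia.
have [mz|nz1] := eqVneq (mir K m z) 1; last by left.
case: odo_step => [->|[[f _ _ h]|]]; [by left| |by lia].
by right; rewrite f; split=> //; lia.
Qed.

Lemma height_edge_act_rev K x y r : 2 <= K -> all (leq^~ K) r ->
  adjacent K x y -> forall m, height_step K m r (edge_act_rev x y r).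
Proof.
move=> hK; elim: r => [|z r IHr] hzr hxy m; first by rewrite /height_step /=; lia.
have /andP[hz hr] := hzr; rewrite [edge_act_rev _ _ _]/=.
(* When the carry reaches and changes the last letter, the word is constant or lies halfway along
   the cycle of {x, y}. *)
have [/andP[all_x cross]|ncross] := boolP (all (pred1 x) r && ((z == x) || (z == y))).
  rewrite all_x {IHr hzr hr} (all_pred1P _ _ all_x) edge_act_rev_nseq.
  have /and3P[hx hy _] := hxy; rewrite /height_step !chain_cons.
  case: (eqVneq z x) cross => [->|nzx] cross.
    rewrite !far_constant // !mirN //.
    by have := adjacent_mir K m x y hxy; rewrite /adjacent; lia.
  have {cross nzx} -> : z = y by case/orP: cross => // /eqP.
  rewrite eqxx.
  have := far_cross K m (size r) x y hK hxy.
  have := far_cross K (~~ m) (size r) x y hK hxy.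
  have := adjacent_mir K m x y hxy; rewrite /first_edge !mirN // /adjacent.
  move: (far K m (x :: _)) (far K m (y :: _)) => F1 F2.
  move: (far K _ (x :: _)) (far K _ (y :: _)) => F3 F4.
  move: (mir K m x) (mir K m y) hK => a b; clear.
  by move=> hK hm [->|[le1 le2 f1]] [->|[le3 le4 f2]]; lia.
have -> : (if all (pred1 x) r then if z == x then y else if z == y then x else z
           else z) = z by case: ifP ncross => //= _; do 2?case: ifP.
have lip := IHr hr hxy.
have := far_step K m x y z r hK hr hz hxy lip ncross.
have := far_step K (~~ m) x y z r hK hr hz hxy lip ncross.
rewrite /height_step !chain_cons; move: (far K) => F.
rewrite !mirN //; case=> [->|[le1 le2 h1]]; case=> [->|[le3 le4 h2]]; try lia.
(* Both depths cannot change: this would force [K = 2] and [z = 1], with the edge inside both {0, 1}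
   and {1, 2}. *)
by move: h1 h2 hxy; rewrite /first_edge /adjacent /mir; case: (m) => /=; lia.
Qed.

Lemma height_edge_act K x y u : 2 <= K -> all (leq^~ K) u -> adjacent K x y ->
  forall m, height_step K m (rev u) (rev (edge_act x y u)).
Proof.
by move=> hK hu hxy; rewrite rev_edge_act; apply: height_edge_act_rev; rewrite ?all_rev.
Qed.

(** * The alternating words, listed from the last letter, and their coordinates *)

Fixpoint endpoint K m n : seq nat :=
  if n is n'.+1 then mir K m 0 :: endpoint K (~~ m) n' else [::].

Lemma size_endpoint K m n : size (endpoint K m n) = n.
Proof. by elim: n m => //= n IHn m; rewrite IHn. Qed.

Lemma all_endpoint K m n : all (leq^~ K) (endpoint K m n).
Proof. by elim: n m => //= n IHn m; rewrite IHn andbT /mir; case: m; lia. Qed.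

Lemma mirK K m z : z <= K -> mir K m (mir K m z) = z.
Proof. by rewrite /mir; case: m; lia. Qed.

Lemma odometer_endpoint K m n : 2 <= K -> odometer K m (endpoint K (~~ m) n) = 0.
Proof.
by move=> hK; case: n m => // n [] /=; rewrite /mir /=; repeat (case: ifP => ?); lia.
Qed.

Lemma chain_endpoint K m n : chain K m (endpoint K m n) = 0.
Proof. by case: n => *; rewrite /chain mirK //; lia. Qed.

Lemma chain_endpointN K m n : 2 <= K -> chain K m (endpoint K (~~ m) n.+1) = K - 2.
Proof. by move=> hK; rewrite chain_cons /mir; case: m => /=; lia. Qed.

Lemma far_endpointN K m n : 2 <= K -> far K m (endpoint K (~~ m) n) = 0.
Proof.
by move=> hK; case: n m => // n [] /=; rewrite /mir /=; repeat (case: ifP => ?); lia.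
Qed.

(** Each further letter adds half a cycle and the whole chain [K - 2], since the alternation puts
    the inner word behind the far end of its copy. *)
Lemma far_endpoint K m n : 2 <= K ->
  far K m (endpoint K m n.+1) = 2 ^ n.+1 - 1 + n * (K - 2).
Proof.
move=> hK; elim: n m => [|n IHn] m; rewrite /= mirK //=.
  by rewrite /chain mirK //=; lia.
have := IHn (~~ m); rewrite -[_ :: endpoint _ _ n]/(endpoint K (~~ m) n.+1) => /= ->.
have := odometer_endpoint K m n.+1 hK; have := chain_endpointN K m n hK.
rewrite /= size_endpoint => -> ->; rewrite subn0 !expnS mulSn.
have : 0 < 2 ^ n by rewrite expn_gt0.
by lia.
Qed.

(** * Transfer to the Schreier graph on tuples *)

Lemma schreier_act K n (o : rel (path_graph K.+1)) u v :
  orientation o -> schreier o (n := n) u v ->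
  exists x y : 'I_K.+1, path_adj x y /\ v = edge_tuple x y u.
Proof.
move=> [ho1 _] /existsP[x /existsP[y /andP[oxy /orP[]/eqP->]]].
  by exists x, y; rewrite permE; split=> //; apply: ho1.
exists y, x; split; first by rewrite path_adj_sym; apply: ho1.
apply: (@perm_inj _ (edge_perm n x y)); rewrite permKV permE.
apply: val_inj; rewrite /= edge_actK //.
by apply/eqP=> exy; have := ho1 _ _ oxy; rewrite exy adj_irr.
Qed.

Lemma act_schreier K n (o : rel (path_graph K.+1))
    (u : n.-tuple 'I_K.+1) (x y : 'I_K.+1) :
  orientation o -> path_adj x y -> schreier o u (edge_tuple x y u).
Proof.
move=> [ho1 ho2] hxy; have := ho2 _ _ hxy.
have [oxy _|noxy /= oyx] := boolP (o x y); apply/existsP.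
  by exists x; apply/existsP; exists y; rewrite oxy permE eqxx.
exists y; apply/existsP; exists x; rewrite oyx /=; apply/orP; right.
apply/eqP; apply: (@perm_inj _ (edge_perm n y x)); rewrite permKV permE.
apply: val_inj; rewrite /= edge_actK //.
by apply/eqP=> exy; have := hxy; rewrite exy path_adj_irr.
Qed.

Lemma all_letters K n (u : n.-tuple 'I_K.+1) : all (leq^~ K) (map val u).
Proof. by apply/allP=> z /mapP[i _ ->]; rewrite /= -ltnS. Qed.

Lemma within_schreier K n (o : rel (path_graph K.+1)) m (u v : n.-tuple 'I_K.+1) :
  orientation o -> within K m (map val u) (map val v) ->
  exists p, [/\ size p <= m, path (schreier o (n := n)) u p & last u p = v].
Proof.
move=> ho hw; have [u' eu] : {u' | u' = map val u} by exists (map val u).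
have [v' ev] : {v' | v' = map val v} by exists (map val v).
rewrite -eu -ev in hw; elim: hw u eu ev => {m u' v'}
  [m u' u eu ev|m u' w v' hs _ IHw u eu ev].
  exists [::]; split=> //=; apply: val_inj; apply: (inj_map val_inj).
  by rewrite -eu.
move: hs; rewrite eu => -[x [y [hx hy hxy ew]]].
pose x' : 'I_K.+1 := inord x; pose y' : 'I_K.+1 := inord y.
have [|p [sp hp lp]] := IHw (edge_tuple x' y' u) _ ev.
  by rewrite ew /= map_edge_act; [rewrite /= !inordK|apply: val_inj].
exists (edge_tuple x' y' u :: p); split=> //=; rewrite hp andbT.
by apply: act_schreier; rewrite // /path_adj !inordK.
Qed.

Lemma height_path K n (o : rel (path_graph K.+1)) m (u : n.-tuple 'I_K.+1) p :
  2 <= K -> orientation o -> path (schreier o (n := n)) u p ->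
  let r := rev (map val u) in let r' := rev (map val (last u p)) in
  chain K m r + far K (~~ m) r + far K m r' <=
    chain K m r' + far K (~~ m) r' + far K m r + size p.
Proof.
move=> hK ho; elim: p u => [|v p IHp] u /=; first by rewrite addn0.
move=> /andP[/(schreier_act _ _ _ _ _ ho)[x [y [hxy ev]]] /IHp].
have hxy' : adjacent K x y.
  by apply/and3P; split=> //; rewrite -ltnS ltn_ord.
have := height_edge_act K x y (map val u) hK (all_letters _ _ u) hxy' m.
rewrite /height_step -map_edge_act; last exact: val_inj.
rewrite ev /=; lia.
Qed.

Lemma endpoint_tuple K n m :
  exists u : n.-tuple 'I_K.+1, rev (map val u) = endpoint K m n.
Proof.
have sz : size (map (@inord K) (rev (endpoint K m n))) == n.
  by rewrite size_map size_rev size_endpoint.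
exists (Tuple sz); rewrite /= -map_comp -map_rev revK -[RHS]map_id.
apply/eq_in_map=> z hz /=; apply: inordK.
by rewrite ltnS; apply: (allP (all_endpoint K m n)).
Qed.

Theorem theorem4p2 (k : nat) (hk : 3 <= k)
  (o : rel (path_graph k)) (ho : orientation o) (n : nat) (hn : 1 <= n) :
  exists H : connected_graph (schreier o (n := n)),
    diam H = 2 ^ (n + 1) + (k - 1) * (2 * n - 1) - 4 * n.
Proof.
case: k hk o ho => // K hK o ho; rewrite ltnS in hK.
case: n hn => // n _.
have -> : 2 ^ (n.+1 + 1) + (K.+1 - 1) * (2 * n.+1 - 1) - 4 * n.+1 =
    2 ^ n.+2 - 2 + n.*2.+1 * (K - 2).
  have : 0 < 2 ^ n by rewrite expn_gt0.
  rewrite addn1 !expnS; move: (2 ^ n) => e he.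
  have [d ->] : exists d, K = d + 2 by exists (K - 2); lia.
  have -> : 2 * n.+1 - 1 = n.*2.+1 by lia.
  rewrite addnK subn1 /= mulnDl [d * _]mulnC; move: (_ * d) => f; lia.
set D := _ + _.
have upper (u v : n.+1.-tuple 'I_K.+1) :
    exists p, [/\ size p <= D, path (schreier o (n := n.+1)) u p & last u p = v].
  apply: within_schreier => //.
  by apply: within_words; rewrite ?size_map ?size_tuple ?all_letters.
have H : connected_graph (schreier o (n := n.+1)).
  move=> u v; have [p [_ hp lp]] := upper u v.
  by exists (size p); apply/existsP; exists (in_tuple p); rewrite hp lp eqxx.
exists H; apply/eqP; rewrite eqn_leq; apply/andP; split.
  apply/bigmax_leqP=> u _; apply/bigmax_leqP=> v _; rewrite /gdist.
  case: ex_minnP => l _ /(_ _ _)/leq_trans; have [p [sp hp lp]] := upper u v.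
  apply; last exact: sp.
  by apply/existsP; exists (in_tuple p); rewrite hp lp eqxx.
have [u eu] := endpoint_tuple K n.+1 true.
have [v ev] := endpoint_tuple K n.+1 false.
apply: leq_trans (leq_bigmax u); apply: leq_trans (leq_bigmax v).
rewrite /gdist; case: ex_minnP => l /existsP[p /andP[hp /eqP lp]] _.
(* With F the value in [far_endpoint], the height falls from [K - 2] + F at [u] to -F at [v], and
   [K - 2] + 2F is [D]. *)
have := height_path K n.+1 o false u p hK ho hp.
rewrite /= lp eu ev size_tuple.
rewrite (chain_endpointN K false) // (far_endpoint K true) // (far_endpoint K false) //.
rewrite chain_endpoint (far_endpointN K true) // (far_endpointN K false) // /D.
have : 0 < 2 ^ n by rewrite expn_gt0.
by rewrite !expnS; lia.
Qed.
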